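(* Let $F$ be a non-Archimedean local field (of arbitrary characteristic). Let $X$ be an $F$-analytic manifold, let $x_0\in X$, and let $f_1,\ldots,f_r:X\to F$ be $F$-analytic functions generating an ideal $J$ (in the ring of $F$-analytic functions on $X$) whose germ $J_{x_0}$ at $x_0$ is non-zero. Then there exists $\epsilon_{x_0}>0$ such that $$\mathrm{lct}_F(J;x_0)>\epsilon_{x_0}.$$
   Context: $F$ is a non-Archimedean local field with ring of integers $\mathcal{O}_F$, residue cardinality $q_F$, and absolute value $|\cdot|_F$, normalized so that a uniformizer $\varpi_F$ satisfies $|\varpi_F|_F=q_F^{-1}$. Fix the Haar measure $\mu_{F^n}$ on $F^n$ such that $\mathcal{O}_F^n$ has volume $1$. For an $F$-analytic manifold $X$ of dimension $n$ with atlas $(U_\alpha,\psi_\alpha:U_\alpha\to F^n)_\alpha$, a smooth measure on $X$ is a measure $\mu$ such that each $(\psi_\alpha)_*(\mu|_{U_\alpha})$ has a locally constant density with respect to the Haar measure on $F^n$; $\mathcal{M}_c^\infty(X)$ denotes the space of compactly supported smooth measures on $X$. Analytic log-canonical threshold: let $J$ be an ideal in the ring of $F$-analytic functions on $X$ whose germ $J_{x_0}$ at $x_0\in X$ is non-zero and is generated by the germs of $F$-analytic functions $f_1,\ldots,f_r:V\to F$ defined on an open neighborhood $V$ of $x_0$. Then $\mathrm{lct}_F(J;x_0)\in[0,\infty]$ is the supremum of all $s\ge 0$ for which there exists an open neighborhood $U\subset V$ of $x_0$ such that for every $\mu\in\mathcal{M}_c^\infty(U)$, $$\int_U \min_{1\le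 i\le r}|f_i(x)|_F^{-s}\,d\mu(x)<\infty$$ (where $0^{-s}=+\infty$ for $s>0$). This does not depend on the choice of generators of $J_{x_0}$. *)

(* Defs.v *)
From HB Require Import structures.
From mathcomp Require Import all_boot all_order all_algebra.
From mathcomp Require Import all_classical all_reals all_analysis.
From mathcomp Require analysis.showcase.summability.

Set Implicit Arguments.
Unset Strict Implicit.
Unset Printing Implicit Defensive.
Import Order.TTheory GRing.Theory Num.Theory.

Local Open Scope classical_set_scope.
Local Open Scope ring_scope.

(* A non-Archimedean local field of any characteristic: a field complete for a
   discrete absolute value with finite residue field.  The library's
   [normedZmodType] cannot be used here, since it imposes
   [`|x *+ n| = `|x| *+ n]. *)
Record localFieldType (R : realType) := LocalField {
  lf_field : fieldType ;
  lf_abs : lf_field -> R ;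
  lf_card : nat ;
  lf_abs_ge0 : forall x, 0 <= lf_abs x ;
  lf_abs_eq0 : forall x, (lf_abs x == 0) = (x == 0) ;
  lf_absM : {morph lf_abs : x y / x * y} ;
  lf_abs_ultra : forall x y, lf_abs (x + y) <= Num.max (lf_abs x) (lf_abs y) ;
  lf_complete : forall u : nat -> lf_field,
    (forall e, 0 < e -> exists N, forall i j, (N <= i)%N -> (N <= j)%N ->
       lf_abs (u i - u j) < e) ->
    exists l, forall e, 0 < e -> exists N, forall i, (N <= i)%N ->
       lf_abs (u i - l) < e ;
  (* [lf_card] is the residue cardinality: [rep] is a system of representatives
     of the quotient of the valuation ring by its maximal ideal. *)
  lf_residue : exists rep : 'I_lf_card -> lf_field,
    (forall i, lf_abs (rep i) <= 1) /\
    (forall x, lf_abs x <= 1 -> exists! i, lf_abs (x - rep i) < 1) ;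
  lf_uniformizer : exists varpi : lf_field, lf_abs varpi = lf_card%:R^-1 /\
    (forall x, lf_abs x < 1 -> lf_abs x <= lf_abs varpi) }.

Definition lf_sort (R : realType) (F : localFieldType R) : Type := lf_field F.
Coercion lf_sort : localFieldType >-> Sortclass.

Section local_field_metric.
Context {R : realType} (F : localFieldType R).

HB.instance Definition _ := GRing.Field.on (lf_sort F).

Definition absF (x : F) : R := lf_abs x.

Let dist (x y : F) : R := absF (x - y).

Lemma absF0 : absF 0 = 0.
Proof. by apply/eqP; rewrite /absF lf_abs_eq0. Qed.

Lemma absF1 : absF 1 = 1.
Proof.
have n0 : absF 1 != 0 by rewrite /absF lf_abs_eq0 oner_eq0.
by apply: (mulfI n0); rewrite mulr1 -[RHS](congr1 absF (mulr1 1)) /absF lf_absM.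
Qed.

Lemma absFN (x : F) : absF (- x) = absF x.
Proof.
have ge0 (y : F) : 0 <= absF y by exact: lf_abs_ge0.
have : absF (-1) ^+ 2 == 1.
  by rewrite expr2 /absF -lf_absM mulrNN mulr1 -/(absF 1) absF1.
rewrite sqrf_eq1 => /orP[/eqP e|/eqP e]; last first.
  by have := ge0 (-1); rewrite e lerNr oppr0 ler10.
by rewrite -mulN1r /absF lf_absM -/(absF (-1)) e mul1r.
Qed.

Let distxx x : dist x x = 0.
Proof. by rewrite /dist subrr absF0. Qed.

Let dist_positivity x y : dist x y = 0 -> x = y.
Proof. by move/eqP; rewrite /dist /absF lf_abs_eq0 subr_eq0 => /eqP. Qed.

Let dist_sym x y : dist x y = dist y x.
Proof. by rewrite /dist -absFN opprB. Qed.

Let dist_triangle y x z : dist x z <= dist x y + dist y z.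
Proof.
rewrite /dist -(subrKA y) (le_trans (lf_abs_ultra _ _))//.
by rewrite ge_max lerDl lerDr !lf_abs_ge0.
Qed.

HB.instance Definition _ := isMetric.Build R (lf_sort F)
  distxx dist_positivity dist_sym dist_triangle.

HB.instance Definition _ := isPointed.Build (lf_sort F) 0.

End local_field_metric.

Notation borel T := (g_sigma_algebraType (@open T)).

Section analytic.
Context {R : realType} {F : localFieldType R}.

(* Unordered convergence of the power series, over finite sets of
   multi-indices. *)
Definition analytic_at n (f : 'rV[F]_n -> F) (a : 'rV[F]_n) : Prop :=
  exists c : {ffun 'I_n -> nat} -> F,
  \forall y \near a,
    summability.partial_sum
      (fun k : {ffun 'I_n -> nat} => c k * \prod_(i < n) ((y : 'rV[F]_n) 0 i - a 0 i) ^+ k i)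
      @ summability.totally --> f y.

(* [chart_inv] is only meaningful on the image of [chart_dom]. *)
Record chart (n : nat) (X : topologicalType) := Chart {
  chart_dom : set X ;
  chart_map :> X -> 'rV[F]_n ;
  chart_inv : 'rV[F]_n -> X ;
  chart_dom_open : open chart_dom ;
  chart_img_open : open (chart_map @` chart_dom) ;
  chart_mapK : {in chart_dom, cancel chart_map chart_inv} ;
  chart_map_continuous : {within chart_dom, continuous chart_map} ;
  chart_inv_continuous :
    {within chart_map @` chart_dom, continuous chart_inv} }.

(* A space with an analytic atlas; neither separation nor countability is
   assumed.  The pointed structure only excludes the empty space. *)
Record manifold (n : nat) := Manifold {
  mf_space :> ptopologicalType ;
  mf_atlas : set (chart n mf_space) ;
  mf_cover : forall x : mf_space, exists2 c, mf_atlas c & chart_dom c x ;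
  mf_compat : forall c d, mf_atlas c -> mf_atlas d ->
    forall x, chart_dom c x -> chart_dom d x ->
    forall j : 'I_n, analytic_at (fun y => d (chart_inv c y) 0 j) (c x) }.

End analytic.

Arguments chart {R} F n X.
Arguments manifold {R} F n.

Section lct.
Context {R : realType} {F : localFieldType R} {n : nat}.
Context (X : manifold F n).

Definition analytic_on (V : set X) (f : X -> F) : Prop :=
  forall c, mf_atlas c -> forall x, V x -> chart_dom c x ->
    analytic_at (f \o chart_inv c) (c x).

Definition analytic_near (x0 : X) (f : X -> F) : Prop :=
  exists2 V, open_nbhs x0 V & analytic_on V f.

Definition analytic_ideal r (f : 'I_r -> X -> F) : set (X -> F) :=
  [set h | exists a : 'I_r -> X -> F, (forall i, analytic_on setT (a i)) /\
    (forall x, h x = \sum_(i < r) a i x * f i x)].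

(* The functions whose germ at [x0] lies in the ideal generated by the germs
   of the members of [J] in the ring of germs of analytic functions. *)
Definition germ_ideal (J : set (X -> F)) (x0 : X) : set (X -> F) :=
  [set h | analytic_near x0 h /\
    exists k (a j : 'I_k -> X -> F),
      [/\ forall i, analytic_near x0 (a i), forall i, J (j i) &
          \forall x \near x0, h x = \sum_(i < k) a i x * j i x]].

Definition germ_neq0 (J : set (X -> F)) (x0 : X) : Prop :=
  exists2 h, germ_ideal J x0 h & ~ (\forall x \near x0, h x = 0).

Definition germ_generators (J : set (X -> F)) (x0 : X) (V : set X)
    r (f : 'I_r -> X -> F) : Prop :=
  [/\ open_nbhs x0 V, forall i, analytic_on V (f i) &
      germ_ideal J x0 = germ_ideal (range f) x0].

Definition is_haar (haar : {measure set (borel 'rV[F]_n) -> \bar R}) : Prop :=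
  (forall (v : 'rV[F]_n) (A : set (borel 'rV[F]_n)), measurable A ->
     haar [set v + y | y in A] = haar A) /\
  haar [set y : 'rV[F]_n | forall i, absF (y 0 i) <= 1] = 1%E.

Context (haar : {measure set (borel 'rV[F]_n) -> \bar R}).

(* A measure on an open subset [U] is represented by its extension by zero to
   [X]; the smoothness condition only concerns its restriction to [U]. *)
Definition smooth_on (U : set X) (mu : {measure set (borel X) -> \bar R}) :
    Prop :=
  forall c, mf_atlas c -> exists g : 'rV[F]_n -> R,
    (forall y, (c @` (U `&` chart_dom c)) y ->
       0 <= g y /\ \forall z \near y, g z = g y) /\
    (forall A : set (borel 'rV[F]_n), measurable A ->
       A `<=` c @` (U `&` chart_dom c) ->
       mu (U `&` chart_dom c `&` c @^-1` A) =
         (\int[haar]_(y in A) (g y)%:E)%E).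

Definition smooth_compact_measure (U : set X)
    (mu : {measure set (borel X) -> \bar R}) : Prop :=
  smooth_on U mu /\
  exists K : set X, [/\ compact K, K `<=` U,
    measurable (K : set (borel X)) & mu (~` K) = 0%E].

(* [((t `^ s)%:E)^-1] is [t] to the power [- s], equal to [+oo] for [t = 0] and
   [0 < s], and to [1] for [s = 0]. *)
Definition integrable_exponent (x0 : X) (V : set X)
    r (f : 'I_r -> X -> F) (s : R) : Prop :=
  exists U : set X, [/\ open_nbhs x0 U, U `<=` V &
    forall mu : {measure set (borel X) -> \bar R},
      smooth_compact_measure U mu ->
      (\int[mu]_(x in U)
         \big[Order.min/+oo]_(i < r) ((absF (f i x) `^ s)%:E)^-1 < +oo)%E].

(* The condition on [s] does not depend on the local generators [f] of the
   germ of [J]; it is imposed for all of them. *)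
Definition lct (J : set (X -> F)) (x0 : X) : \bar R :=
  ereal_sup [set s%:E | s in [set s : R | 0 <= s /\
    forall (V : set X) r (f : 'I_r -> X -> F),
      germ_generators J x0 V f -> integrable_exponent x0 V f s]].

End lct.

(* Main.v *)
Require Import Defs.
From HB Require Import structures.
From mathcomp Require Import all_boot all_order all_algebra.
From mathcomp Require Import all_classical all_reals all_analysis.
From mathcomp Require Import measurable_realfun finmap.
From mathcomp Require analysis.showcase.summability.

(** Why the theorem holds.  Fix one function [h] in the germ ideal whose germ
    at [x0] is not zero.  Near [x0] it is a combination of any given generators
    with bounded coefficients, so that [absF h] is at most a constant times the
    largest absolute value of a generator ([germ_ideal_bound]).  It is thus
    enough to integrate a small negative power of [absF h], and the exponent
    found for [h] serves all systems of generators at once.  On a chart a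
    smooth measure with compact support is at most a multiple of the Haar
    measure ([smooth_measure_le]), and a negative power is integrable as soon
    as the Haar measure of the sublevel sets [absF h < t] decays like a power
    of [t] ([sublevel_integrable]).

    This decay ([haar_sublevel_le]) comes from interpolation on parallel lines,
    which takes the place of derivatives and so works in every characteristic.
    Expand [h] in a power series at [x0], let [P] be its form of lowest degree
    [N], and choose a vector [v] with [P v != 0] ([form_nonvanishing]).  The
    divided difference of order [N] of [h] at [N + 1] points of a line directed
    by [v] is, up to scaling, the sum of [P v] and of terms that are negligible
    close to [x0]; hence
    [h] cannot be small at [N + 1] points of such a line that are far apart
    ([series_large_value_on_line]).  Let [q] be the residue cardinality.  The
    ring of integers contains [q ^ m] points at mutual distances at least
    [q ^- m] ([residue_system]); translate a sublevel set along [v] by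
    multiples given by these points.  Each point lies in at most [N] of the
    [q ^ m] translates, which all have the same measure and lie in a polydisc of
    measure at most [1].  Their common measure is therefore at most
    [N * q ^- m] ([haar_overlap]), at a level [t] proportional to
    [q ^- (m * N)]. *)

Set Implicit Arguments.
Unset Strict Implicit.
Unset Printing Implicit Defensive.
Import Order.TTheory GRing.Theory Num.Theory.

Local Open Scope classical_set_scope.
Local Open Scope ring_scope.

(** * The absolute value of a local field *)

Section absolute_value.
Context {R : realType} {F : localFieldType R}.
Implicit Types x y : F.

Lemma absF_ge0 x : 0 <= absF x.
Proof. exact: lf_abs_ge0. Qed.

Lemma absF_eq0 x : (absF x == 0) = (x == 0).
Proof. exact: lf_abs_eq0. Qed.

Lemma absF_gt0 x : (0 < absF x) = (x != 0).
Proof. by rewrite lt_def absF_ge0 andbT absF_eq0. Qed.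

Lemma absFM x y : absF (x * y) = absF x * absF y.
Proof. exact: lf_absM. Qed.

Lemma absFX x k : absF (x ^+ k) = absF x ^+ k.
Proof. by elim: k => [|k IH]; rewrite ?expr0 ?absF1// !exprS absFM IH. Qed.

Lemma absFV x : absF x^-1 = (absF x)^-1.
Proof.
have [->|x0] := eqVneq x 0; first by rewrite invr0 absF0 invr0.
have n0 : absF x != 0 by rewrite absF_eq0.
by apply: (mulfI n0); rewrite -absFM !divff// absF1.
Qed.

Lemma absF_prod (I : Type) (r : seq I) (P : pred I) (f : I -> F) :
  absF (\prod_(i <- r | P i) f i) = \prod_(i <- r | P i) absF (f i).
Proof. by apply: big_morph; [exact: absFM|exact: absF1]. Qed.

Lemma absFB_sym x y : absF (x - y) = absF (y - x).
Proof. by rewrite -absFN opprB. Qed.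

Lemma absF_ultra x y : absF (x + y) <= Num.max (absF x) (absF y).
Proof. exact: lf_abs_ultra. Qed.

Lemma absFD_le (M : R) x y : absF x <= M -> absF y <= M -> absF (x + y) <= M.
Proof. by move=> xM yM; rewrite (le_trans (absF_ultra _ _))// ge_max xM. Qed.

Lemma absFD_lt (M : R) x y : absF x < M -> absF y < M -> absF (x + y) < M.
Proof. by move=> xM yM; rewrite (le_lt_trans (absF_ultra _ _))// gt_max xM. Qed.

Lemma absF_sum_le (M : R) (I : Type) (r : seq I) (P : pred I) (f : I -> F) :
  0 <= M -> (forall i, P i -> absF (f i) <= M) ->
  absF (\sum_(i <- r | P i) f i) <= M.
Proof.
move=> M0 fM; elim/big_ind : _ => //; first by rewrite absF0.
by move=> x y; exact: absFD_le.
Qed.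

Lemma absF_sum_lt (M : R) (I : Type) (r : seq I) (P : pred I) (f : I -> F) :
  0 < M -> (forall i, P i -> absF (f i) < M) ->
  absF (\sum_(i <- r | P i) f i) < M.
Proof.
move=> M0 fM; elim/big_ind : _ => //; first by rewrite absF0.
by move=> x y; exact: absFD_lt.
Qed.

(** In an isosceles triangle the two longest sides have the same length. *)
Lemma absF_dominant x y : absF y < absF x -> absF (x + y) = absF x.
Proof.
move=> yx; apply/eqP; rewrite eq_le; apply/andP; split.
  by apply: absFD_le => //; exact: ltW.
rewrite leNgt; apply/negP => xyx.
have : absF ((x + y) + - y) < absF x by apply: absFD_lt => //; rewrite absFN.
by rewrite addrK ltxx.
Qed.

(** The elements [0] and [1] are not congruent modulo the maximal ideal. *)
Lemma lf_card_gt1 : (1 < lf_card F)%N.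
Proof.
have [rep [_ repP]] := lf_residue F.
have [i [/= i0 _]] : exists! i, absF (0 - rep i) < 1.
  by apply: repP; rewrite -/(absF _) absF0.
have [j [/= j1 _]] : exists! i, absF (1 - rep i) < 1.
  by apply: repP; rewrite -/(absF _) absF1.
case: (lf_card F) rep i j i0 j1 {repP} => [|[|//]] rep i j; first by case: i.
rewrite (ord1 i) (ord1 j) absFB_sym => i0 j1.
by have := absFD_lt j1 i0; rewrite subr0 subrK absF1 ltxx.
Qed.

Lemma ltr1_lf_card : 1 < (lf_card F)%:R :> R.
Proof. by rewrite ltr1n lf_card_gt1. Qed.

Lemma lf_card_gt0 : 0 < (lf_card F)%:R :> R.
Proof. exact: lt_trans ltr1_lf_card. Qed.

(** Expansions in powers of a uniformizer whose digits represent the residue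
    field.  A pair of them is separated at the first digit in which it
    differs. *)
Lemma residue_system m : exists T : seq F,
  [/\ size T = (lf_card F ^ m)%N, uniq T, {in T, forall x, absF x <= 1} &
      {in T &, forall x y, x != y -> (lf_card F)%:R ^- m <= absF (x - y)}].
Proof.
have [rep [rep1 repP]] := lf_residue F.
have [pi [piE _]] := lf_uniformizer F.
rewrite -/(absF pi) in piE.
have q0 := lf_card_gt0.
have pi0 : pi != 0 by rewrite -absF_gt0 piE invr_gt0.
have pi1 : absF pi < 1 by rewrite piE invf_lt1// ltr1_lf_card.
have repI i j : absF (rep i - rep j) < 1 -> i = j.
  move=> ij; have [k [_ kU]] := repP _ (rep1 i).
  by rewrite -(kU i) ?(kU j)// -/(absF _) subrr absF0 ltr01.
elim: m => [|m [T [sT uT T1 TD]]].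
  exists [:: 0]; split => //.
    by move=> x; rewrite inE => /eqP ->; rewrite absF0 ler01.
  by move=> x y; rewrite !inE => /eqP -> /eqP ->; rewrite eqxx.
pose g i (t : F) : F := rep i + pi * t.
have gD i j t u : g i t - g j u = (rep i - rep j) + pi * (t - u).
  by rewrite /g opprD addrACA mulrBr.
have piT t : t \in T -> absF (pi * t) < 1.
  by move=> tT; rewrite absFM (le_lt_trans _ pi1)// ler_piMr ?absF_ge0// T1.
have gij i j t u : t \in T -> u \in T -> i != j -> 1 <= absF (g i t - g j u).
  move=> tT uT' ij; rewrite leNgt; apply: contra_neqN ij => gl.
  apply: repI; have -> : rep i - rep j = (g i t - g j u) - pi * (t - u).
    by rewrite gD addrK.
  apply: absFD_lt => //; rewrite absFN mulrBr.
  by apply: absFD_lt; rewrite ?absFN; exact: piT.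
exists [seq g i t | i <- enum 'I_(lf_card F), t <- T]; split.
- by rewrite size_allpairs size_enum_ord sT expnS.
- apply: allpairs_uniq => //; first exact: enum_uniq.
  move=> [i t] [j u] /allpairsP[[i' t'] /= [_ t'T [-> ->]]].
  move=> /allpairsP[[j' u'] /= [_ u'T [-> ->]]] /eqP.
  rewrite -subr_eq0 => /eqP e.
  have ij : i' = j'.
    apply/eqP; apply: contraT => /(gij _ _ _ _ t'T u'T).
    by rewrite e absF0 ler10.
  congr (_, _) => //; apply/eqP; rewrite -subr_eq0; move/eqP: e.
  by rewrite gD ij subrr add0r mulf_eq0 (negbTE pi0).
- move=> _ /allpairsP[[i t] /= [_ tT ->]]; apply: absFD_le; first exact: rep1.
  exact/ltW/piT.
- move=> _ _ /allpairsP[[i t] /= [_ tT ->]] /allpairsP[[j u] /= [_ uT' ->]] gg.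
  have [ij|ij] := eqVneq i j; last first.
    rewrite (le_trans _ (gij _ _ _ _ tT uT' ij))//.
    by rewrite invf_le1 ?exprn_gt0// exprn_ege1// ltW// ltr1_lf_card.
  rewrite gD ij subrr add0r absFM piE exprS invfM ler_wpM2l ?invr_ge0 ?ler0n//.
  apply: TD => //; apply: contraNneq gg => ->.
  by rewrite ij eqxx.
Qed.

(** * Divided differences *)

(** The weights are those of the [N]-th divided difference: they compute the
    coefficient of degree [N] of the polynomial interpolating a function at the
    points of [s].  The recursion is
    [dd_(x :: s) p = dd_s ((p - p(x)) / (X - x))], and for a monomial [p] this
    quotient has integral coefficients. *)
Lemma divided_difference (e : R) N (s : seq F) : 0 < e ->
  size s = N.+1 -> uniq s -> {in s, forall x, absF x <= 1} ->
  {in s &, forall x y, x != y -> e <= absF (x - y)} ->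
  exists w : F -> F,
    [/\ {in s, forall x, absF (w x) <= e ^- N},
        forall j, (j <= N)%N -> \sum_(x <- s) w x * x ^+ j = (j == N)%:R &
        forall j, absF (\sum_(x <- s) w x * x ^+ j) <= 1].
Proof.
move=> e0; elim: N s => [|N IH] [//|x s] /=.
  move=> [/size0nil ->] _ s1 _; exists (fun=> 1); split => //.
  - by move=> y _; rewrite absF1 expr0 invr1.
  - by move=> j; rewrite leqn0 => /eqP ->; rewrite big_seq1 expr0 mulr1.
  - move=> j; rewrite big_seq1 mul1r absFX exprn_ile1 ?absF_ge0// s1//.
    by rewrite inE.
move=> [sz] /andP[xs us] s1 sD.
have s1' : {in s, forall x, absF x <= 1}.
  by move=> y ys; apply: s1; rewrite inE ys orbT.
have [] := IH s sz us s1'.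
  by move=> y z ys zs; apply: sD; rewrite inE ?ys ?zs orbT.
move=> w [wle wE w1].
have yx y : y \in s -> y != x by move=> ys; apply: contraNneq xs => <-.
have eV k : 0 <= e ^- k by rewrite invr_ge0 exprn_ge0// ltW.
have wle' y : y \in s -> absF (w y / (y - x)) <= e ^- N.+1.
  move=> ys; rewrite absFM absFV exprSr invfM; apply: ler_pM => //.
  - exact: absF_ge0.
  - by rewrite invr_ge0 absF_ge0.
  - exact: wle.
  - rewrite lef_pV2// ?posrE ?absF_gt0 ?subr_eq0 ?yx//.
    by apply: sD; rewrite ?inE ?eqxx ?ys ?orbT ?yx.
pose w' y := if y == x then - \sum_(z <- s) w z / (z - x) else w y / (y - x).
have w'E j : \sum_(y <- x :: s) w' y * y ^+ j =
    \sum_(l < j) x ^+ (j.-1 - l) * \sum_(y <- s) w y * y ^+ l.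
  rewrite big_cons {1}/w' eqxx mulNr addrC big_seq.
  under eq_bigr => y ys do rewrite /w' (negbTE (yx _ ys)).
  rewrite -big_seq mulr_suml -sumrB.
  under [RHS]eq_bigr do rewrite mulr_sumr.
  rewrite exchange_big [LHS]big_seq [RHS]big_seq; apply: eq_bigr => y ys.
  rewrite -mulrBr subrXX mulrA divfK ?subr_eq0 ?yx// mulr_sumr.
  have [->|j0] := posnP j; first by rewrite !big_ord0.
  rewrite (reindex_inj rev_ord_inj)/=; apply: eq_bigr => l _.
  have -> : (j - l.+1 = j.-1 - l)%N by rewrite -subn1 -subnDA add1n.
  rewrite subKn; last by rewrite -ltnS prednK.
  by rewrite [RHS]mulrCA; congr (_ * _); rewrite mulrC.
exists w'; split.
- move=> y; rewrite inE /w'; case: eqVneq => [_ _|/= _ ys]; last exact: wle'.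
  rewrite absFN big_seq; apply: absF_sum_le => // z zs; exact: wle'.
- move=> j jN; rewrite w'E; case: j jN => [_|j]; first by rewrite big_ord0.
  rewrite !ltnS => jN; rewrite eqSS big_ord_recr/= subnn mul1r wE//.
  rewrite big1 ?add0r// => l _; rewrite wE ?ltn_eqF ?mulr0//.
    by rewrite (leq_trans _ jN)// ltn_ord.
  by rewrite (leq_trans _ jN)// ltnW// ltn_ord.
- move=> j; rewrite w'E; apply: absF_sum_le => // l _; rewrite absFM absFX.
  rewrite mulr_ile1 ?absF_ge0// ?exprn_ge0 ?absF_ge0//.
  by rewrite exprn_ile1 ?absF_ge0// s1// inE eqxx.
Qed.

End absolute_value.

(** * Convergence in a local field *)

Section power_series.
Context {R : realType} {F : localFieldType R}.
Local Notation q := (lf_card F).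

Lemma nbhs_rowP n (a : 'rV[F]_n) (P : set 'rV[F]_n) :
  nbhs a P <-> exists2 e : R, 0 < e &
    forall y : 'rV[F]_n, (forall i, absF (y 0 i - a 0 i) < e) -> P y.
Proof.
rewrite nbhs_ballP; split => -[e /= e0 eP]; exists e => // y ye.
  apply: eP; split => // i j; rewrite ballEmdist/= ord1.
  by rewrite (_ : mdist _ _ = absF (a 0 j - y 0 j))// absFB_sym.
apply: eP => i; case: ye => _ /(_ 0 i); rewrite ballEmdist/=.
by rewrite (_ : mdist _ _ = absF (a 0 i - y 0 i))// absFB_sym.
Qed.

Lemma cvg_absFP (T : Type) (G : set_system T) {FG : Filter G} (u : T -> F)
    (l : F) :
  u @ G --> l <-> forall e : R, 0 < e -> \forall A \near G, absF (u A - l) < e.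
Proof.
split.
  move=> /cvg_ballP ul e e0; have := ul e e0; apply: filterS => A.
  by rewrite ballEmdist/= (_ : mdist _ _ = absF (l - u A))// absFB_sym.
move=> ul; apply/cvg_ballP => e e0; apply: filterS (ul e e0) => A.
by rewrite ballEmdist/= (_ : mdist _ _ = absF (l - u A))// absFB_sym.
Qed.

Lemma cvg_lincomb (T : Type) (G : set_system T) {FG : Filter G}
    (s : seq F) (w l : F -> F) (u : F -> T -> F) :
  (forall x, x \in s -> u x @ G --> l x) ->
  (fun A => \sum_(x <- s) w x * u x A) @ G --> \sum_(x <- s) w x * l x.
Proof.
elim: s => [|x s IH] ul.
  apply/cvg_absFP => e e0; apply: nearW => A.
  by rewrite !big_nil subr0 absF0.
have {}IH : (fun A => \sum_(x <- s) w x * u x A) @ G -->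
    \sum_(x <- s) w x * l x.
  by apply: IH => y ys; apply: ul; rewrite inE ys orbT.
move/cvg_absFP : IH => IH.
have /cvg_absFP ux : u x @ G --> l x by apply: ul; rewrite inE eqxx.
apply/cvg_absFP => e e0.
have e1 : 0 < e / (absF (w x) + 1).
  by rewrite divr_gt0// ltr_wpDl// absF_ge0.
apply: filterS2 (IH e e0) (ux _ e1) => A Ae Ax.
rewrite !big_cons opprD addrACA -mulrBr; apply: absFD_lt => //.
rewrite absFM; move: Ax; rewrite ltr_pdivlMr ?ltr_wpDl ?absF_ge0//.
apply: le_lt_trans; rewrite mulrC ler_wpM2l ?absF_ge0//.
by rewrite lerDl ler01.
Qed.

Lemma cvg_absF_le (T : Type) (G : set_system T) {FG : ProperFilter G}
    (u : T -> F) (l p : F) (M : R) :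
  u @ G --> l -> (\forall A \near G, absF (u A - p) <= M) ->
  absF (l - p) <= M.
Proof.
move=> /cvg_absFP ul uM; rewrite leNgt; apply/negP => Ml.
have /ul {}ul : 0 < absF (l - p).
  have [A AM] := filter_ex uM.
  by rewrite (le_lt_trans _ Ml)// (le_trans _ AM)// absF_ge0.
have [A [Au AM]] := filter_ex (filterI ul uM).
suff : absF (l - p) < absF (l - p) by rewrite ltxx.
rewrite -{1}(subrK (u A) l) -addrA; apply: absFD_lt.
  move: Au => /=. by rewrite absFB_sym.
exact: le_lt_trans AM Ml.
Qed.

Lemma small_element (e : R) : 0 < e ->
  exists x : F, [/\ x != 0, absF x <= 1 & absF x < e].
Proof.
move=> e0; have [pi [piE _]] := lf_uniformizer F; rewrite -/(absF pi) in piE.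
have pi0 : pi != 0 by rewrite -absF_gt0 piE invr_gt0 lf_card_gt0.
have [m me] : exists m : nat, e^-1 < m%:R.
  by exists (Num.trunc e^-1).+1; exact: truncnS_gt.
exists (pi ^+ m); rewrite expf_neq0// absFX piE; split => //.
  rewrite exprn_ile1// ?invr_ge0 ?ler0n// invf_le1 ?lf_card_gt0//.
  exact/ltW/ltr1_lf_card.
have qm : m%:R < q%:R ^+ m :> R.
  by rewrite -natrX ltr_nat ltn_expl// lf_card_gt1.
rewrite exprVn invf_plt ?posrE ?exprn_gt0 ?lf_card_gt0//.
exact: lt_trans qm.
Qed.

(** * Multi-indices and forms *)

Section multi_index.
Context {n : nat}.
Implicit Types (k : {ffun 'I_n -> nat}) (y : 'rV[F]_n).

Definition degree k := (\sum_(i < n) k i)%N.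

Definition monomial k y : F := \prod_(i < n) y 0 i ^+ k i.

Lemma monomialZ x k y : monomial k (x *: y) = x ^+ degree k * monomial k y.
Proof.
rewrite /monomial /degree expr_sum -big_split; apply: eq_bigr => i _ /=.
by rewrite mxE exprMn.
Qed.

Lemma absF_monomial_le (d : R) k y : 0 <= d ->
  (forall i, absF (y 0 i) <= d) -> absF (monomial k y) <= d ^+ degree k.
Proof.
move=> d0 yd; rewrite /monomial absF_prod /degree expr_sum.
apply: ler_prod => i _; rewrite absF_ge0 absFX/=.
by rewrite lerXn2r ?nnegrE ?absF_ge0.
Qed.

Lemma ord_le_degree k i : (k i <= degree k)%N.
Proof. by rewrite /degree (bigD1 i)//= leq_addr. Qed.

(** The entries of a multi-index are at most its degree, which presents the
    multi-indices of degree [d] as a finite set. *)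
Definition indices_of_degree d : {fset {ffun 'I_n -> nat}} :=
  [fset k in [seq [ffun i => val (g i)] | g : {ffun 'I_n -> 'I_d.+1}]
    | degree k == d]%fset.

Lemma mem_indices_of_degree d k : (k \in indices_of_degree d) = (degree k == d).
Proof.
rewrite !inE/=; case: eqVneq => [kd|]; last by rewrite andbF.
rewrite andbT; apply/mapP => /=.
have kn i : (k i < d.+1)%N by rewrite ltnS -kd ord_le_degree.
exists [ffun i => Ordinal (kn i)]; rewrite ?mem_enum//.
by apply/ffunP => i; rewrite !ffunE.
Qed.

End multi_index.

Lemma digits_inj D n (k l : 'I_n -> nat) :
  (forall i, k i < D)%N -> (forall i, l i < D)%N ->
  (\sum_(i < n) k i * D ^ i = \sum_(i < n) l i * D ^ i)%N -> k =1 l.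
Proof.
elim: n k l => [|n IH] k l kD lD; first by move=> _ [].
have shift (g : 'I_n.+1 -> nat) :
    (\sum_(i < n.+1) g i * D ^ i =
     (\sum_(i < n) g (lift ord0 i) * D ^ i) * D + g ord0)%N.
  rewrite big_ord_recl/= expn0 muln1 addnC big_distrl/=; congr addn.
  by apply: eq_bigr => i _; rewrite /bump/= add1n expnSr mulnA.
have D0 : (0 < D)%N by rewrite (leq_ltn_trans _ (kD ord0)).
rewrite !shift => e.
have e0 : k ord0 = l ord0.
  by have := congr1 (modn^~ D) e; rewrite /= !modnMDl !modn_small.
have {}e : (\sum_(i < n) k (lift ord0 i) * D ^ i =
            \sum_(i < n) l (lift ord0 i) * D ^ i)%N.
  by have := congr1 (divn^~ D) e; rewrite /= !divnMDl// !divn_small// !addn0.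
move=> i; case: (unliftP ord0 i) => [j|] -> //.
exact: (IH _ _ (fun=> kD _) (fun=> lD _) e).
Qed.

(** The Kronecker substitution [v i = x ^ ((d + 1) ^ i)] sends distinct monomials
    of degree [d] to distinct powers of [x], so that the form becomes a nonzero
    polynomial in one variable, which has finitely many roots. *)
Lemma form_nonvanishing n (c : {ffun 'I_n -> nat} -> F) d k0 :
  degree k0 = d -> c k0 != 0 ->
  exists v : 'rV[F]_n, (forall i, absF (v 0 i) <= 1) /\
    \sum_(k <- indices_of_degree d) c k * monomial k v != 0.
Proof.
move=> k0d ck0.
pose code (k : {ffun 'I_n -> nat}) := (\sum_(i < n) k i * d.+1 ^ i)%N.
have codeI k : degree k = d -> code k = code k0 -> k = k0.
  move=> kd /digits_inj kk0; apply/ffunP; apply: kk0 => i.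
    by rewrite ltnS -kd ord_le_degree.
  by rewrite ltnS -k0d ord_le_degree.
pose p : {poly F} := \sum_(k <- indices_of_degree d) c k *: 'X^(code k).
have p0 : p != 0.
  apply: contraNneq ck0 => /(congr1 (fun p : {poly F} => p`_(code k0))).
  rewrite coef0 coef_sum (big_fsetD1 k0)/=; last first.
    by rewrite mem_indices_of_degree k0d.
  rewrite coefZ coefXn eqxx mulr1 big_seq big1 ?addr0 => [->//|k].
  rewrite in_fsetD1 mem_indices_of_degree => /andP[kk0 /eqP kd].
  rewrite coefZ coefXn; case: eqVneq => [e|]; last by rewrite mulr0.
  by rewrite (codeI k kd (esym e)) eqxx in kk0.
have [T [sT uT T1 _]] := residue_system (F := F) (size p).
have /allPn[x xT px] : ~~ all (root p) T.
  apply/negP => pT; have := max_poly_roots p0 pT uT.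
  by rewrite sT ltnNge ltnW// ltn_expl// lf_card_gt1.
exists (\row_i x ^+ (d.+1 ^ i)); split => [i|].
  by rewrite mxE absFX exprn_ile1 ?absF_ge0 ?T1.
move: px; rewrite /root /p horner_sum; congr (_ != 0).
apply: eq_bigr => k _; rewrite hornerZ hornerXn; congr (_ * _).
rewrite /monomial /code expr_sum; apply: eq_bigr => i _.
by rewrite mxE -exprM mulnC.
Qed.

(** * Divided differences of monomials on a line *)

Section divided_difference_monomial.
Context {n : nat} (u v : 'rV[F]_n).
Context (u1 : forall i, absF (u 0 i) <= 1) (v1 : forall i, absF (v 0 i) <= 1).
Implicit Types k : {ffun 'I_n -> nat}.

Let line_poly k : {poly F} := \prod_(i < n) ((u 0 i)%:P + v 0 i *: 'X) ^+ k i.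

Let line_polyE k x : (line_poly k).[x] = monomial k (u + x *: v).
Proof.
rewrite /line_poly horner_prod; apply: eq_bigr => i _.
by rewrite horner_exp !hornerE !mxE [x * _]mulrC.
Qed.

Let integral (p : {poly F}) := forall j, absF p`_j <= 1.

Let integralM p p' : integral p -> integral p' -> integral (p * p').
Proof.
move=> p1 p'1 j; rewrite coefM; apply: absF_sum_le => // i _.
by rewrite absFM mulr_ile1 ?absF_ge0.
Qed.

Let integral1 : integral 1.
Proof. by move=> j; rewrite coef1; case: eqP; rewrite ?absF1 ?absF0. Qed.

Let line_poly_integral k : integral (line_poly k).
Proof.
rewrite /line_poly; elim/big_ind : _ => // i _.
elim: (k i) => // m IH; rewrite exprS; apply: integralM IH => j.
rewrite coefD coefC coefZ coefX; apply: absFD_le.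
  by case: eqP; rewrite ?absF0.
by case: eqP; rewrite ?mulr1 ?mulr0 ?absF0.
Qed.

(* The degree bound and the top coefficient are multiplicative only together. *)
Let top d a (p : {poly F}) := (size p <= d.+1)%N /\ p`_d = a.

Let topM d a p d' a' p' : top d a p -> top d' a' p' ->
  top (d + d') (a * a') (p * p').
Proof.
move=> [sp pa] [sp' pa']; split.
  apply: leq_trans (size_polyMleq _ _) _.
  by rewrite -subn1 leq_subLR add1n -addnS -addSn leq_add.
have dd : (d < (d + d').+1)%N by rewrite ltnS leq_addr.
rewrite coefM (bigD1 (Ordinal dd))//= addKn pa pa' big1 ?addr0// => i id_.
have [lt|gt|e] := ltngtP i d.
- rewrite [X in _ * X]nth_default ?mulr0// (leq_trans sp')//.
  by rewrite ltn_subRL ltn_add2r.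
- by rewrite nth_default ?mul0r// (leq_trans sp).
- by move: id_; rewrite -val_eqE/= e eqxx.
Qed.

Let top1 : top 0 1 1.
Proof. by rewrite /top size_poly1 coef1. Qed.

Let line_poly_top k : top (degree k) (monomial k v) (line_poly k).
Proof.
rewrite /degree /monomial /line_poly.
elim: (index_enum _) => [|i r IH]; first by rewrite !big_nil.
rewrite !big_cons; apply: topM IH.
elim: (k i) => // m IH; rewrite !exprS -add1n; apply: topM IH.
split; last by rewrite coefD coefC coefZ coefX/= add0r mulr1.
rewrite (leq_trans (size_polyD _ _))// geq_max (leq_trans (size_polyC_leq1 _))//.
by rewrite (leq_trans (size_scale_leq _ _))// size_polyX.
Qed.

(** Restricted to a line, a monomial of degree [d] is a polynomial of degree
    at most [d] with integral coefficients, whose coefficient of degree [d]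
    only depends on the direction of the line. *)
Lemma divided_difference_monomial N (s : seq F) (w : F -> F) k :
  (forall j, (j <= N)%N -> \sum_(x <- s) w x * x ^+ j = (j == N)%:R) ->
  (forall j, absF (\sum_(x <- s) w x * x ^+ j) <= 1) ->
  absF (\sum_(x <- s) w x * monomial k (u + x *: v)) <= 1 /\
  (degree k = N ->
     \sum_(x <- s) w x * monomial k (u + x *: v) = monomial k v).
Proof.
move=> wE w1.
have -> : \sum_(x <- s) w x * monomial k (u + x *: v) =
    \sum_(j < size (line_poly k)) (line_poly k)`_j * \sum_(x <- s) w x * x ^+ j.
  under eq_bigr do rewrite -line_polyE horner_coef mulr_sumr.
  rewrite exchange_big; apply: eq_bigr => j _; rewrite mulr_sumr.
  by apply: eq_bigr => x _; rewrite mulrCA.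
split.
  apply: absF_sum_le => // j _; rewrite absFM mulr_ile1 ?absF_ge0//.
  exact: line_poly_integral.
have [+ <-] := line_poly_top k; move=> + kN; rewrite kN => sz.
have -> : \sum_(j < size (line_poly k))
      (line_poly k)`_j * (\sum_(x <- s) w x * x ^+ j) =
    \sum_(j < N.+1) (line_poly k)`_j * (\sum_(x <- s) w x * x ^+ j).
  rewrite (big_ord_widen _ (fun j =>
    (line_poly k)`_j * (\sum_(x <- s) w x * x ^+ j)) sz).
  rewrite big_mkcond; apply: eq_bigr => j _; case: ltnP => // ?.
  by rewrite nth_default ?mul0r.
rewrite big_ord_recr/= wE// eqxx mulr1 big1 ?add0r// => j _.
by rewrite wE ?ltn_eqF ?mulr0// ltnW.
Qed.

End divided_difference_monomial.
End power_series.

(** * Power series *)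

Section analytic_germ.
Context {R : realType} {F : localFieldType R} {n : nat}.
Local Notation q := (lf_card F).
Local Notation index := {ffun 'I_n -> nat}.
Implicit Types (f : 'rV[F]_n -> F) (a y : 'rV[F]_n) (c : index -> F).

#[local] Existing Instance summability.totally_filter.

Lemma near_totally (I : choiceType) (A0 : {fset I}) (P : set {fset I}) :
  (forall A, (A0 `<=` A)%fset -> P A) ->
  \forall A \near summability.totally, P A.
Proof. by move=> AP; exists A0. Qed.

Lemma partial_sumE (I : choiceType) (t : I -> F) (A : {fset I}) :
  summability.partial_sum t A = \sum_(k <- A) t k.
Proof. by rewrite big_seq_fsetE. Qed.

Definition has_series f a c (rho : R) := 0 < rho /\
  forall y, (forall i, absF (y 0 i) < rho) ->
    summability.partial_sum (fun k => c k * monomial k y)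
      @ summability.totally --> f (a + y).

Lemma analytic_at_has_series f a :
  analytic_at f a -> exists c rho, has_series f a c rho.
Proof.
move=> [c /nbhs_rowP[rho rho0 fc]]; exists c, rho; split => // y yrho.
have {fc} := fc (a + y).
rewrite (_ : (fun k => _) = fun k => c k * monomial k y).
  by apply => i; rewrite mxE [a 0 i + _]addrC addrK.
apply/funext => k; congr (_ * _); apply: eq_bigr => i _.
by rewrite mxE [a 0 i + _]addrC addrK.
Qed.

(** The terms of a convergent family tend to zero, so that convergence at a
    point with all coordinates equal to [mu] gives Cauchy's estimate. *)
Lemma series_coef_bound f a c rho : has_series f a c rho ->
  exists (mu : F) (M : R), [/\ mu != 0, absF mu <= 1, absF mu < rho, 0 <= M &
    forall k, absF (c k) * absF mu ^+ degree k <= M].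
Proof.
move=> [rho0 fc]; have [mu [mu0 mu1 murho]] := small_element (F := F) rho0.
pose y : 'rV[F]_n := const_mx mu.
have {}fc : summability.partial_sum
    (fun k => c k * monomial k y) @ summability.totally --> f (a + y).
  by apply: fc => i; rewrite mxE.
have [A0 _ A0P] := (cvg_absFP _ _).1 fc _ ltr01.
pose M := 1 + \sum_(k <- A0) absF (c k * monomial k y).
have sum_ge0 : 0 <= \sum_(k <- A0) absF (c k * monomial k y).
  by apply: sumr_ge0 => k _; exact: absF_ge0.
exists mu, M; split => //; first by rewrite addr_ge0.
move=> k.
have -> : absF (c k) * absF mu ^+ degree k = absF (c k * monomial k y).
  rewrite absFM -absFX; congr (_ * absF _).
  rewrite /monomial /degree expr_sum; apply: eq_bigr => i _.
  by rewrite mxE.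
have [kA0|kA0] := boolP (k \in A0).
  rewrite /M (big_fsetD1 k)//= addrCA lerDl addr_ge0//.
  by apply: sumr_ge0 => ? _; exact: absF_ge0.
apply: le_trans (_ : 1 <= M); last by rewrite lerDl.
have S0 : absF (\sum_(k <- A0) c k * monomial k y - f (a + y)) < 1.
  by have := A0P A0; rewrite /= partial_sumE; apply.
have := A0P (k |` A0)%fset; rewrite /= partial_sumE big_fsetU1//=.
move=> /(_ (fsubsetUr _ _)) S1; apply/ltW.
rewrite -(addrK (\sum_(k <- A0) c k * monomial k y - f (a + y)) (_ * _)).
by apply: absFD_lt; rewrite ?absFN// addrA.
Qed.

Lemma degree_eq0 (k : index) : degree k = 0%N -> k = [ffun=> 0%N].
Proof.
move=> k0; apply/ffunP => i; rewrite ffunE; apply/eqP.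
by rewrite -leqn0 -k0 ord_le_degree.
Qed.

(** By Cauchy's estimate all nonconstant terms are small near the centre, and
    in an ultrametric field so is their sum. *)
Lemma analytic_at_continuous f a : analytic_at f a -> {for a, continuous f}.
Proof.
move=> /analytic_at_has_series[c [rho fc]].
have [mu [M [mu0 mu1 murho M0 cM]]] := series_coef_bound fc.
have amu0 : 0 < absF mu by rewrite absF_gt0.
(* Every nonconstant term is at most [M * (d / absF mu) ^ degree], hence at most
   [M * (d / absF mu)] since its degree is positive. *)
have est (d : R) y : 0 <= d -> d <= absF mu -> (forall i, absF (y 0 i) <= d) ->
    absF (f (a + y) - c [ffun=> 0%N]) <= M * (d / absF mu).
  move=> d0 dmu yd.
  have dm0 : 0 <= d / absF mu by rewrite divr_ge0// ltW.
  have dm1 : d / absF mu <= 1 by rewrite ler_pdivrMr// mul1r.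
  apply: (@cvg_absF_le _ _ _ summability.totally _ _ _ _ _ (fc.2 y _)).
    by move=> i; rewrite (le_lt_trans (yd i))// (le_lt_trans dmu).
  apply: (near_totally (A0 := [fset [ffun=> 0%N]]%fset)) => A.
  rewrite fsub1set => A0; rewrite partial_sumE (big_fsetD1 _ A0)/=.
  rewrite [monomial _ _]big1 ?mulr1; last by move=> i _; rewrite ffunE.
  rewrite addrAC subrr add0r big_seq; apply: absF_sum_le; first exact: mulr_ge0.
  move=> k; rewrite in_fsetD1 => /andP[k0 _]; rewrite absFM.
  apply: le_trans (_ : absF (c k) * d ^+ degree k <= _).
    by rewrite ler_wpM2l ?absF_ge0// absF_monomial_le.
  rewrite -[X in X ^+ _](divfK (lt0r_neq0 amu0)) exprMn mulrCA mulrC.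
  apply: ler_pM; rewrite ?mulr_ge0 ?absF_ge0 ?exprn_ge0 ?absF_ge0//.
  have : degree k != 0%N by apply: contra_neqN k0 => /eqP/degree_eq0.
  by case: (degree k) => // m _; rewrite exprS ler_piMr ?exprn_ile1.
apply/(cvg_absFP (FG := nbhs_filter a)) => e e0; apply/nbhs_rowP.
pose d := Num.min (absF mu) (e * absF mu / (M + 1) / 2).
have M1 : 0 < M + 1 by rewrite ltr_wpDl.
have d0 : 0 < d by rewrite lt_min amu0 !divr_gt0// mulr_gt0.
have de : M * (d / absF mu) < e.
  apply: (@le_lt_trans _ _ (M * (e / (M + 1) / 2))).
    rewrite ler_wpM2l// ler_pdivrMr//.
    rewrite (_ : _ * absF mu = e * absF mu / (M + 1) / 2) ?ge_min ?lexx ?orbT//.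
    by rewrite mulrAC [e / _ * _]mulrAC.
  rewrite -mulrA mulrCA gtr_pMr// -invfM ltr_pdivrMr ?mulr_gt0// mul1r.
  by rewrite mulr_natr mulr2n ltr_wpDr ?ltrDl// ltW.
exists d => // y yd; rewrite (_ : y = a + (y - a)); last by rewrite addrC subrK.
rewrite -(subrKA (c [ffun=> 0%N])); apply: (le_lt_trans _ de).
apply: absFD_le.
  apply: est; rewrite ?(ltW d0) ?ge_min ?lexx// => i.
  by rewrite !mxE ltW.
rewrite absFB_sym -[X in f X]addr0; apply: est; rewrite ?(ltW d0) ?ge_min ?lexx//.
by move=> i; rewrite mxE absF0 ltW.
Qed.

Lemma series_neq0 f a c rho : has_series f a c rho ->
  ~ (\forall y \near a, f y = 0) -> exists k, c k != 0.
Proof.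
move=> [rho0 fc] f0; apply: contrapT => c0; apply: f0.
apply/nbhs_rowP; exists rho => // y yrho; apply/eqP.
rewrite -absF_eq0 eq_le absF_ge0 andbT -[f y]subr0.
rewrite (_ : y = a + (y - a)); last by rewrite addrC subrK.
apply: (@cvg_absF_le _ _ _ summability.totally _ _ _ _ _ (fc (y - a) _)).
  by move=> i; rewrite !mxE.
apply: nearW => A; rewrite subr0 partial_sumE big1 ?absF0// => k _.
have [->|ck] := eqVneq (c k) 0; first by rewrite mul0r.
by case: c0; exists k.
Qed.

(** Let [P] be the lowest degree form of the series, [N] its degree, and [v] a
    vector with [P v != 0].  On a line with direction [v], the [N]-th divided
    difference of [P] is [P v] whatever the base point, and that of the terms
    of higher degree is negligible after shrinking by [lam].  Hence the divided
    difference of [f] has a constant absolute value, while it is at most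
    [e ^- N] times the largest value of [f] on [e]-separated points. *)
Lemma series_large_value_on_line f a c rho :
  has_series f a c rho -> (exists k, c k != 0) ->
  exists (N : nat) (lam : F) (v : 'rV[F]_n) (kap : R),
    [/\ lam != 0, absF lam <= 1, 0 < kap, forall i, absF (v 0 i) <= 1 &
    forall (u : 'rV[F]_n) (e : R) (s : seq F),
      (forall i, absF (u 0 i) <= 1) -> 0 < e ->
      size s = N.+1 -> uniq s -> {in s, forall x, absF x <= 1} ->
      {in s &, forall x x', x != x' -> e <= absF (x - x')} ->
      exists2 x, x \in s & kap * e ^+ N <= absF (f (a + lam *: (u + x *: v)))].
Proof.
move=> fc c0.
pose hasdeg d := `[< exists k, c k != 0 /\ degree k = d >].
have /ex_minnP[N /asboolP[k0 [ck0 k0N]] Nmin] : exists d, hasdeg d.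
  by have [k ck] := c0; exists (degree k); apply/asboolP; exists k.
have [v [v1]] := form_nonvanishing k0N ck0.
set Pv := \sum_(k <- _) _ => Pv0.
have [mu [M [mu0 mu1 murho M0 cM]]] := series_coef_bound fc.
have amu0 : 0 < absF mu by rewrite absF_gt0.
have aPv0 : 0 < absF Pv by rewrite absF_gt0.
have M1 : 0 < M + 1 by rewrite ltr_wpDl.
(* A term of degree [d > N] has absolute value at most [M * absF x ^ d] on the
   polydisc of radius [absF (mu * x)], to be compared with [kap], which is of
   the order of [absF x ^ N]. *)
have [x [x0 x1 xM]] : exists x : F, [/\ x != 0, absF x <= 1 &
    absF x < absF mu ^+ N * absF Pv / (M + 1)].
  by apply: small_element; rewrite divr_gt0// mulr_gt0// exprn_gt0.
have ax0 : 0 < absF x by rewrite absF_gt0.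
pose lam := mu * x.
pose kap := absF (lam ^+ N * Pv).
have tail : M * absF x ^+ N.+1 < kap.
  rewrite /kap absFM absFX absFM exprMn exprS mulrA [ltRHS]mulrAC.
  rewrite ltr_pM2r ?exprn_gt0//.
  move: xM; rewrite ltr_pdivlMr//; apply: le_lt_trans.
  by rewrite mulrC ler_wpM2l// ?absF_ge0// lerDl.
have lammu : absF lam <= absF mu by rewrite absFM ler_piMr// absF_ge0.
exists N, lam, v, kap; split => //.
- by rewrite mulf_neq0.
- exact: le_trans lammu mu1.
- by rewrite absF_gt0 mulf_neq0// expf_neq0// mulf_neq0.
move=> u e s u1 e0 sN us s1 sD.
have [w [wle wE w1]] := divided_difference e0 sN us s1 sD.
pose z t := u + t *: v.
have z1 t : t \in s -> forall i, absF (z t 0 i) <= 1.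
  move=> ts i; rewrite !mxE; apply: absFD_le => //.
  by rewrite absFM mulr_ile1 ?absF_ge0// s1.
pose L := \sum_(t <- s) w t * f (a + lam *: z t).
have Llim : (fun A => \sum_(t <- s) w t * summability.partial_sum
    (fun k => c k * monomial k (lam *: z t)) A) @ summability.totally --> L.
  apply: cvg_lincomb => t ts; apply: fc.2 => i.
  rewrite mxE absFM (le_lt_trans _ murho)// (le_trans _ lammu)//.
  by rewrite ler_piMr ?absF_ge0// z1.
have LP : absF (L - lam ^+ N * Pv) <= M * absF x ^+ N.+1.
  apply: (cvg_absF_le Llim).
  apply: (near_totally (A0 := indices_of_degree N)) => A AN.
  pose D (k : index) := \sum_(t <- s) w t * monomial k (z t).
  have -> : \sum_(t <- s) w t * summability.partial_sum
        (fun k => c k * monomial k (lam *: z t)) A =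
      \sum_(k <- A) c k * lam ^+ degree k * D k.
    under eq_bigr do rewrite partial_sumE mulr_sumr.
    rewrite exchange_big; apply: eq_bigr => k _; rewrite mulr_sumr.
    by apply: eq_bigr => t _; rewrite monomialZ [RHS]mulrCA -mulrA.
  have DP k := divided_difference_monomial u1 v1 k wE w1.
  rewrite (big_fsetID _ (mem (indices_of_degree N)))/=.
  have -> : [fset k in A | k \in indices_of_degree N]%fset = indices_of_degree N.
    apply/fsetP => k; rewrite !inE/= andb_idl// => kN.
    by apply: (fsubsetP AN); rewrite !inE.
  have -> : \sum_(k <- indices_of_degree N) c k * lam ^+ degree k * D k =
      lam ^+ N * Pv.
    rewrite /Pv mulr_sumr big_seq [RHS]big_seq; apply: eq_bigr => k.
    rewrite mem_indices_of_degree => /eqP kN.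
    have -> : D k = monomial k v by exact: (DP k).2.
    by rewrite kN [RHS]mulrCA mulrA.
  rewrite addrAC subrr add0r big_seq; apply: absF_sum_le => [|k].
    by rewrite mulr_ge0// exprn_ge0// absF_ge0.
  move=> kA; have {kA} kN : degree k != N.
    by rewrite -mem_indices_of_degree; move: kA; rewrite !inE/= => /andP[].
  have [->|ck] := eqVneq (c k) 0.
    by rewrite !mul0r absF0 mulr_ge0// exprn_ge0// absF_ge0.
  have Nk : (N < degree k)%N.
    by rewrite ltn_neqAle eq_sym kN Nmin//; apply/asboolP; exists k.
  rewrite !absFM absFX absFM exprMn mulrA -[leRHS]mulr1.
  have xk : absF x ^+ degree k <= absF x ^+ N.+1.
    by rewrite ler_wiXn2l// absF_ge0.
  apply: ler_pM; rewrite ?mulr_ge0 ?exprn_ge0 ?absF_ge0//; last exact: (DP k).1.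
  by apply: ler_pM; rewrite ?mulr_ge0 ?exprn_ge0 ?absF_ge0.
(* [L] is dominated by its leading part [lam ^+ N * Pv]. *)
have aL : absF L = kap.
  rewrite /kap -(subrK (lam ^+ N * Pv) L) addrC absF_dominant//.
  exact: le_lt_trans LP tail.
have [/hasP[t ts tk]|/hasPn sk] :=
  boolP (has (fun t => kap * e ^+ N <= absF (f (a + lam *: z t))) s).
  by exists t.
suff : absF L < kap by rewrite aL ltxx.
rewrite /L big_seq; apply: absF_sum_lt => [|t ts].
  by rewrite -aL aL (le_lt_trans _ tail)// mulr_ge0// exprn_ge0// absF_ge0.
rewrite absFM; have := sk t ts; rewrite -ltNge => fk.
apply: (@le_lt_trans _ _ (e ^- N * absF (f (a + lam *: z t)))).
  by rewrite ler_wpM2r ?absF_ge0// wle.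
by rewrite mulrC ltr_pdivrMr ?exprn_gt0.
Qed.

End analytic_germ.

(** * The Haar measure of sublevel sets *)

Section haar_sublevel.
Context {R : realType} {F : localFieldType R} {n : nat}.
Local Notation q := (lf_card F).

Lemma measurable_open (A : set 'rV[F]_n) :
  open A -> measurable (A : set (borel 'rV[F]_n)).
Proof. by move=> oA; exact: sub_sigma_algebra. Qed.

Lemma open_rowP (A : set 'rV[F]_n) :
  (forall y, A y -> exists2 e : R, 0 < e &
    forall z : 'rV[F]_n, (forall i, absF (z 0 i - y 0 i) < e) -> A z) -> open A.
Proof. by move=> AP; rewrite openE => y /AP ?; exact/nbhs_rowP. Qed.

Lemma open_translate (t : 'rV[F]_n) (A : set 'rV[F]_n) :
  open A -> open [set t + y | y in A].
Proof.
rewrite openE => oA; apply: open_rowP => _ [y Ay <-].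
have /nbhs_rowP[e e0 eA] := oA y Ay; exists e => // z ze.
exists (z - t); last by rewrite addrC subrK.
apply: eA => i; have := ze i; rewrite !mxE.
by rewrite opprD addrA.
Qed.

Definition polydisc (a : 'rV[F]_n) (d : R) : set 'rV[F]_n :=
  [set y | forall i, absF (y 0 i - a 0 i) <= d].

Lemma open_polydisc a d : 0 < d -> open (polydisc a d).
Proof.
move=> d0; apply: open_rowP => y yB; exists d => // z zy i.
rewrite -(subrKA (y 0 i)); apply: absFD_le => //; exact/ltW.
Qed.

Context (haar : {measure set (borel 'rV[F]_n) -> \bar R}) (haarP : is_haar haar).

Lemma haar_polydisc_le1 a d : 0 < d -> d <= 1 -> (haar (polydisc a d) <= 1)%E.
Proof.
move=> d0 d1; have [inv <-] := haarP.
have -> : [set y : 'rV[F]_n | forall i, absF (y 0 i) <= 1] = polydisc 0 1.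
  by apply/seteqP; split => y /= y1 i; have := y1 i; rewrite mxE subr0.
have m0 := measurable_open (open_polydisc (a := 0) (d := 1) ltr01).
rewrite -(inv a _ m0).
apply: le_measure.
- by apply: mem_set; apply: measurable_open; exact: open_polydisc.
- by apply: mem_set; apply: measurable_open; apply/open_translate/open_polydisc.
- move=> y /= yB; exists (y - a); last by rewrite addrC subrK.
  by move=> i; rewrite !mxE subr0 (le_trans (yB i)).
Qed.

(** The integral over [B] of the number of translates of [E] that contain a
    point is the sum of their measures, all equal to that of [E]. *)
Lemma haar_overlap (B E : set 'rV[F]_n) (T : seq F) (g : F -> 'rV[F]_n) (N : nat) :
  open B -> open E ->
  {in T, forall t, [set g t + y | y in E] `<=` B} ->
  (forall z, B z ->
     (count (fun t => z \in [set (g t + y)%R | y in E]) T <= N)%N) ->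
  ((size T)%:R%:E * haar E <= N%:R%:E * haar B)%E.
Proof.
move=> oB oE TB TN; have mB := measurable_open oB.
pose S t := [set (g t + y : 'rV[F]_n) | y in E].
have mS t : measurable (S t : set (borel 'rV[F]_n)).
  by apply: measurable_open; exact: open_translate.
have -> : ((size T)%:R%:E * haar E = \sum_(t <- T) haar (S t))%E.
  rewrite (eq_bigr (fun=> haar E)) => [|t _].
    elim: T {TB TN} => [|t T IH] /=; first by rewrite big_nil mul0e.
    rewrite big_cons -IH -natr1 addrC EFinD ge0_muleDl ?mul1e//.
  by apply: haarP.1; exact: measurable_open.
have -> : (\sum_(t <- T) haar (S t) =
    \int[haar]_(z in B) (\sum_(t <- T) (\1_(S t) z)%:E))%E.
  rewrite ge0_integral_sum//.
  - rewrite big_seq [RHS]big_seq; apply: eq_bigr => t tT.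
    by rewrite integral_indic// setIidl//; exact: TB.
  - by move=> t; exact/measurable_EFinP/measurable_indic.
have -> : (N%:R%:E * haar B = \int[haar]_(z in B) (N%:R)%:E)%E.
  by rewrite integral_cst.
apply: ge0_le_integral => //.
- by move=> z _; apply: sume_ge0 => t _; rewrite lee_fin.
- apply: emeasurable_sum => t; exact/measurable_EFinP/measurable_indic.
move=> z Bz; rewrite sumEFin lee_fin.
rewrite (eq_bigr (fun t => (z \in S t)%:R)) => [|t _]; last by rewrite indicE.
rewrite -natr_sum ler_nat (leq_trans _ (TN z Bz))//.
rewrite -sum1_count [leqRHS]big_mkcond/=; apply: leq_sum => t _.
by case: (z \in _).
Qed.

(** A function with a value of size [kap * e ^+ N] among any [N + 1] points at
    mutual distances [e] on a line is smaller at no more than [N] of the points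
    [y + lam * t *: v], where [t] ranges over the residues modulo the [m]-th
    power of the maximal ideal and [e] is [q ^- m]. *)
Lemma haar_sublevel_le (f : 'rV[F]_n -> F) a c rho :
  has_series f a c rho -> (exists k, c k != 0) ->
  exists (N : nat) (lam : F) (kap : R), [/\ lam != 0, absF lam <= 1, 0 < kap &
    forall m (E : set 'rV[F]_n), open E ->
      E `<=` polydisc a (absF lam) ->
      (forall y, E y -> absF (f y) < kap * (q%:R ^- m) ^+ N) ->
      (haar E <= (N%:R * q%:R ^- m)%:E)%E].
Proof.
move=> fc c0.
have [N [lam [v [kap [lam0 lam1 kap0 v1 fL]]]]] :=
  series_large_value_on_line fc c0.
exists N, lam, kap; split => // m E oE EB Ef.
have [T [sT uT T1 TD]] := residue_system (F := F) m.
have alam0 : 0 < absF lam by rewrite absF_gt0.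
have qm0 : 0 < q%:R ^+ m :> R by rewrite exprn_gt0// lf_card_gt0.
(* With this sign, [z] lies in the translate of [E] by [g t] if and only if
   [z + lam * t *: v] lies in [E]. *)
pose g (t : F) : 'rV[F]_n := - (lam * t *: v).
have oB : open (polydisc a (absF lam)) by exact: open_polydisc.
have TB : {in T, forall t, [set g t + y | y in E] `<=` polydisc a (absF lam)}.
  move=> t tT _ [y /EB yB <-] i; rewrite !mxE -addrA.
  apply: absFD_le; last exact: yB.
  by rewrite absFN -mulrA absFM ler_piMr ?absF_ge0// absFM mulr_ile1 ?absF_ge0// T1.
have := haar_overlap oB oE TB; move=> /(_ N) overlap.
rewrite mulrC EFinM lee_pdivlMl// -natrX -sT.
apply: (le_trans (overlap _)) => [z zB|]; last first.
  rewrite -[leRHS]mule1; apply: lee_wpmul2l; first by rewrite lee_fin.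
  exact: haar_polydisc_le1.
rewrite leqNgt; apply/negP => NT.
pose p t := z \in [set g t + y | y in E].
have sp : (N.+1 <= size ([seq t <- T | p t]))%N by rewrite size_filter.
pose s := take N.+1 ([seq t <- T | p t]).
have sP t : t \in s -> p t /\ t \in T.
  by move=> /mem_take; rewrite mem_filter => /andP.
pose u := lam^-1 *: (z - a).
have [||||||x xs] := fL u (q%:R ^- m) s.
- by move=> i; rewrite !mxE absFM absFV ler_pdivrMl// mulr1.
- by rewrite invr_gt0.
- by rewrite size_takel.
- by rewrite take_uniq// filter_uniq.
- by move=> t /sP[_]; exact: T1.
- by move=> t t' /sP[_ tT] /sP[_ t'T]; exact: TD.
have [/set_mem[y Ey gy] _] := sP x xs.
have -> : a + lam *: (u + x *: v) = y.
  rewrite scalerDr scalerA divff// scale1r addrA [a + _]addrC subrK -gy /g.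
  by rewrite scalerA addrAC addNr add0r.
by rewrite leNgt Ef.
Qed.

End haar_sublevel.

(** * Integrals of negative powers *)

Section integrability.
Import numFieldNormedType.Exports.
Context d (T : measurableType d) (R : realType).
Context (mu : {measure set T -> \bar R}).

(** The integral of a nonnegative function is a supremum over the simple
    functions below it, hence monotone without measurability. *)
Lemma ge0_integral_mono (D : set T) (f g : T -> \bar R) :
  (forall x, D x -> 0 <= f x)%E -> (forall x, D x -> f x <= g x)%E ->
  (\int[mu]_(x in D) f x <= \int[mu]_(x in D) g x)%E.
Proof.
move=> f0 fg; rewrite !ge0_integralE// => [|x Dx]; last first.
  exact: le_trans (f0 x Dx) (fg x Dx).
apply: le_ereal_sup => _ [h hf <-]; exists h => // x.
apply: le_trans (hf x) _; rewrite /patch; case: ifPn => // /set_mem Dx.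
exact: fg.
Qed.

Lemma nneseries_geometric_lty (u : nat -> \bar R) (A b : R) :
  (forall m, 0 <= u m)%E -> (forall m, u m <= (A * b ^+ m)%:E)%E ->
  0 < b -> b < 1 -> (\sum_(0 <= m <oo) u m < +oo)%E.
Proof.
move=> u0 uA b0 b1.
have A0 : 0 <= A.
  by have := le_trans (u0 0%N) (uA 0%N); rewrite lee_fin expr0 mulr1.
apply: (@le_lt_trans _ _ (A / (1 - b))%:E); last by rewrite ltry.
apply: lime_le; first by apply: is_cvg_nneseries => m _ _; exact: u0.
apply: nearW => m; apply: le_trans (_ : (\sum_(0 <= i < m) (A * b ^+ i)%:E <= _)%E).
  by apply: lee_sum => i _; exact: uA.
rewrite sumEFin lee_fin; apply: geometric_le_lim => //.
by rewrite ger0_norm// ltW.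
Qed.

(** Cut [U] along the levels [kap * theta ^ m] of [g]: the negative power [s] of
    [g] is at most a constant times [theta ^- (s * m)] on the [m]-th shell,
    whose measure is at most [A * b ^ m]. *)
Lemma sublevel_integrable (U : set T) (g : T -> R) (phi : T -> \bar R)
    (kap theta A b s K : R) :
  measurable U -> (mu U < +oo)%E -> 0 < kap -> 0 < theta -> theta < 1 ->
  0 < s -> 0 < b -> b < theta `^ s -> 0 <= K ->
  (forall m, measurable (U `&` [set x | g x < kap * theta ^+ m])) ->
  (forall m, (mu (U `&` [set x | (g x < kap * theta ^+ m)%R]) <=
              (A * b ^+ m)%:E)%E) ->
  (forall x, U x -> 0 <= g x) -> (forall x, U x -> 0 <= phi x)%E ->
  (forall x, U x -> g x != 0 -> (phi x <= (K / g x `^ s)%:E)%E) ->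
  (\int[mu]_(x in U) phi x < +oo)%E.
Proof.
move=> mU Ufin kap0 theta0 theta1 s0 b0 bs K0 mS SA g0 phi0 phiK.
pose t m := kap * theta ^+ m.
have t0 m : 0 < t m by rewrite mulr_gt0// exprn_gt0.
pose S m := U `&` [set x | g x < t m].
pose p := theta `^ s.
have p0 : 0 < p by exact: powR_gt0.
have p1 : p < 1.
  have : theta `^ s < 1 `^ s by rewrite gt0_ltr_powR ?nnegrE ?(ltW theta0).
  by rewrite powR1.
(* With [K + 1] instead of [K] these weights are positive, so that the bound
   [Phi] below is infinite at the zeros of [g]. *)
pose alpha m := (K + 1) / t m `^ s.
have K1 : 0 < K + 1 by rewrite ltr_wpDl.
have tE m : t m `^ s = kap `^ s * p ^+ m.
  rewrite /t powRM ?exprn_ge0 ?ltW//; congr (_ * _).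
  elim: m => [|m IH]; first by rewrite !expr0 powR1.
  by rewrite !exprS powRM ?exprn_ge0 ?ltW// IH.
have alpha0 m : 0 < alpha m by rewrite divr_gt0// powR_gt0.
have alpha_le m : alpha 0%N <= alpha m.
  rewrite /alpha ler_pM2l// lef_pV2 ?posrE ?powR_gt0//.
  by rewrite !tE ler_pM2l ?powR_gt0// expr0 exprn_ile1// ltW.
have phi_alpha x m : U x -> t m <= g x -> (phi x <= (alpha m)%:E)%E.
  move=> Ux tg; have gx0 : 0 < g x by exact: lt_le_trans tg.
  apply: (le_trans (phiK x Ux _)); first by rewrite gt_eqF.
  rewrite lee_fin /alpha ler_pM// ?invr_ge0 ?powR_ge0// ?lerDl//.
  rewrite lef_pV2 ?posrE ?powR_gt0//.
  by rewrite ge0_ler_powR ?nnegrE// ?ltW.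
pose F m x := ((alpha m.+1)%:E * (\1_(S m) x)%:E)%E.
have F0 m x : (0 <= F m x)%E by rewrite mule_ge0 ?lee_fin ?(ltW (alpha0 _)).
have mF m : measurable_fun U (F m).
  apply: emeasurable_funM => //.
  apply/measurable_EFinP; apply: measurable_indic; exact: mS.
pose Phi x := ((alpha 0%N)%:E + \sum_(0 <= m <oo) F m x)%E.
have sum0 x : (0 <= \sum_(0 <= m <oo) F m x)%E by apply: nneseries_ge0 => *.
have FS m x : S m x -> F m x = (alpha m.+1)%:E.
  by move=> Sx; rewrite /F indicE mem_set// mule1.
have phiPhi x : U x -> (phi x <= Phi x)%E.
  move=> Ux; have [gx|gx] := leP (t 0%N) (g x).
    by apply: le_trans (phi_alpha _ _ Ux gx) _; rewrite leeDl.
  have [gx0|gx0] := eqVneq (g x) 0.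
    suff -> : Phi x = +oo%E by rewrite leey.
    rewrite /Phi; suff -> : (\sum_(0 <= m <oo) F m x = +oo)%E by [].
    apply: eq_infty => r.
    apply: (@le_trans _ _ (\sum_(0 <= m < (Num.trunc (r / alpha 0%N)).+1) F m x)%E);
      last by apply: nneseries_lim_ge => *.
    rewrite (eq_bigr (fun m => (alpha m.+1)%:E)) => [|m _]; last first.
      by rewrite FS//; split => //=; rewrite gx0.
    rewrite sumEFin lee_fin.
    apply: (@le_trans _ _ (\sum_(0 <= m < (Num.trunc (r / alpha 0%N)).+1) alpha 0%N)).
      rewrite sumr_const_nat subn0 -mulr_natl -ler_pdivrMr//.
      exact/ltW/truncnS_gt.
    exact: ler_sum.
  have {}gx0 : 0 < g x by rewrite lt_def gx0 g0.
  have [m tm] : exists m, t m <= g x.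
    have [m mg] : exists m : nat, theta ^+ m < g x / kap.
      have theta_lt1 : `|theta| < 1 by rewrite ger0_norm// ltW.
      have /cvgr0Pnorm_lt/(_ _ (divr_gt0 gx0 kap0))[m _ mP] :=
        cvg_geometric 1 theta_lt1.
      exists m; have := mP m (leqnn m).
      by rewrite /= mul1r ger0_norm// exprn_ge0// ltW.
    by exists m; rewrite /t mulrC -ler_pdivlMr// ltW.
  have [m' tm' min] := ex_minnP (ex_intro (fun m => t m <= g x) m tm).
  case: m' tm' min => [|m'] tm' min; first by rewrite leNgt gx in tm'.
  have Sx : S m' x.
    by split => //=; rewrite ltNge; apply/negP => /min; rewrite ltnn.
  apply: le_trans (phi_alpha _ _ Ux tm') _; rewrite -(FS _ _ Sx).
  apply: le_trans (_ : _ <= \sum_(0 <= m <oo) F m x)%E _; last first.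
    by rewrite leeDr// lee_fin ltW.
  apply: le_trans (nneseries_lim_ge m'.+1 _) => //.
  by rewrite big_nat_recr//= leeDr// sume_ge0.
apply: (le_lt_trans (ge0_integral_mono phi0 phiPhi)).
have mFsum : measurable_fun U (fun x => \sum_(0 <= m <oo) F m x)%E.
  by apply: ge0_emeasurable_sum.
rewrite /Phi ge0_integralD// => [|x _]; last by rewrite lee_fin ltW.
rewrite integral_cst// integral_nneseries//; apply: lte_add_pinfty.
  by rewrite lte_mul_pinfty// lee_fin ltW.
apply: (@nneseries_geometric_lty _ (alpha 1%N * A) (b / p)).
- by move=> m; apply: integral_ge0.
- move=> m; rewrite ge0_integralZl//; last 2 first.
  + by apply/measurable_EFinP; apply: measurable_indic; exact: mS.
  + by rewrite lee_fin ltW.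
  rewrite integral_indic//; last exact: mS.
  rewrite setIidl; last by move=> x [].
  apply: (@le_trans _ _ ((alpha m.+1)%:E * (A * b ^+ m)%:E)%E).
    by apply: lee_wpmul2l; [rewrite lee_fin ltW|exact: SA].
  rewrite -EFinM lee_fin le_eqVlt; apply/orP; left; apply/eqP.
  rewrite /alpha !tE expr1 exprS expr_div_n !invfM.
  by rewrite -!mulrA; congr (_ * (_ * (_ * _))); rewrite mulrCA; congr (_ * _);
     rewrite mulrC.
- by rewrite divr_gt0.
- by rewrite ltr_pdivrMr// mul1r.
Qed.

End integrability.

(** * Charts, germs and smooth measures *)

Section on_manifold.
Context {R : realType} {F : localFieldType R} {n : nat} (X : manifold F n).
Implicit Types (c : chart F n X) (x : X).

Lemma measurable_open_manifold (A : set X) :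
  open A -> measurable (A : set (borel X)).
Proof. by move=> oA; exact: sub_sigma_algebra. Qed.

Lemma chart_continuous c x : chart_dom c x -> {for x, continuous c}.
Proof.
move=> cx; have := @chart_map_continuous _ _ _ _ c.
rewrite continuous_open_subspace; last exact: chart_dom_open.
by apply; exact: mem_set.
Qed.

Lemma open_chart_preimage c (W : set 'rV[F]_n) :
  open W -> open (chart_dom c `&` c @^-1` W).
Proof.
apply: (continuous_inP c (chart_dom_open c)).1.
by move=> x /set_mem; exact: chart_continuous.
Qed.

Lemma chart_invK c x : chart_dom c x -> chart_inv c (c x) = x.
Proof. by move=> cx; apply: chart_mapK; exact: mem_set. Qed.

Lemma open_chart_image c (A : set X) :
  open A -> A `<=` chart_dom c -> open (c @` A).
Proof.
move=> oA Ac.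
have -> : c @` A = c @` chart_dom c `&` chart_inv c @^-1` A.
  apply/seteqP; split => y /=.
    move=> [x Ax <-]; rewrite chart_invK; last exact: Ac.
    by split => //; exists x => //; exact: Ac.
  move=> [[x cx <-]]; rewrite chart_invK// => Ax; by exists x.
have /(continuous_inP _ (@chart_img_open _ _ _ _ c)) : {in c @` chart_dom c, continuous (chart_inv c)}.
  rewrite -continuous_open_subspace; first exact: chart_inv_continuous.
  exact: chart_img_open.
by apply.
Qed.

Lemma nbhs_chart c x (P : set 'rV[F]_n) (Q : set X) :
  chart_dom c x -> nbhs (c x) P ->
  (forall x', chart_dom c x' -> P (c x') -> Q x') -> nbhs x Q.
Proof.
move=> cx cP PQ.
have dx : nbhs x (chart_dom c).
  by apply: open_nbhs_nbhs; split => //; exact: chart_dom_open.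
apply: filterS2 dx (chart_continuous cx cP) => x'; exact: PQ.
Qed.

Lemma analytic_near_bounded x (a : X -> F) : analytic_near x a ->
  exists2 M : R, 0 < M & \forall x' \near x, absF (a x') <= M.
Proof.
move=> [V [oV Vx] aV]; have [c ac cx] := mf_cover x.
have /analytic_at_continuous := aV c ac x Vx cx.
move=> /(cvg_absFP (FG := nbhs_filter (c x)))/(_ _ ltr01) near1.
exists (absF (a x) + 1); first by rewrite ltr_wpDl// absF_ge0.
apply: (nbhs_chart cx near1) => x' cx' /=; rewrite (chart_invK cx') (chart_invK cx) => d1.
rewrite -(subrK (a x) (a x')); apply: absFD_le; last by rewrite lerDl.
by rewrite (le_trans (ltW d1))// lerDr absF_ge0.
Qed.

(** The coefficients of [h] in the generators are bounded near [x], hence [h]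
    is controlled by the largest generator.  One function [h] thus
    serves all systems of generators. *)
Lemma germ_ideal_bound r (f : 'I_r -> X -> F) x (h : X -> F) :
  germ_ideal (range f) x h ->
  exists2 M : R, 0 < M & \forall x' \near x,
    h x' != 0 -> exists i, absF (h x') <= M * absF (f i x').
Proof.
move=> [_ [k [a [j [an jf hE]]]]].
have /choice[C CP] : forall i, exists C : R,
    0 < C /\ \forall x' \near x, absF (a i x') <= C.
  by move=> i; have [C C0 CP] := analytic_near_bounded (an i); exists C.
have /choice[sigma sigmaP] : forall i, exists l, f l = j i.
  by move=> i; have [l _ <-] := jf i; exists l.
have C_ge0 i : 0 <= C i by exact/ltW/(CP i).1.
pose M := 1 + \sum_(i < k) C i.
have CM i : C i <= M.
  by rewrite /M (bigD1 i)//= addrCA lerDl addr_ge0// sumr_ge0.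
have M0 : 0 < M by rewrite ltr_pwDl// sumr_ge0.
exists M => //.
have aM : \forall x' \near x, forall i, absF (a i x') <= C i.
  by apply: filter_forall => i; exact: (CP i).2.
apply: filterS2 hE aM => x' hx' ax' h0.
apply: contrapT => /forallNP hf.
suff : absF (h x') < absF (h x') by rewrite ltxx.
rewrite {1}hx'; apply: absF_sum_lt; first by rewrite absF_gt0.
move=> i _; rewrite absFM -sigmaP.
apply: le_lt_trans (_ : M * absF (f (sigma i) x') < _).
  by rewrite ler_wpM2r ?absF_ge0// (le_trans (ax' i)).
by rewrite ltNge; apply/negP/hf.
Qed.

Context (haar : {measure set (borel 'rV[F]_n) -> \bar R}).

(** The density is locally constant, hence bounded on the image of the compact
    set that carries the measure; the points where it exceeds this bound lie
    outside that set and do not contribute. *)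
Lemma smooth_measure_le (U : set X) c (mu : {measure set (borel X) -> \bar R}) :
  mf_atlas c -> open U -> U `<=` chart_dom c ->
  smooth_compact_measure haar U mu ->
  exists2 G : R, 0 <= G & forall E : set 'rV[F]_n, open E -> E `<=` c @` U ->
    (mu (U `&` c @^-1` E) <= G%:E * haar E)%E.
Proof.
move=> ac oU Uc [smu [K [cK KU mK K0]]].
have [g] := smu c ac; rewrite (setIidl Uc) => -[gP gE].
have [G KG] : exists G : nat, K `<=` [set x | g (c x) <= G%:R].
  have : \forall G \near \oo, K `<=` [set x | g (c x) <= G%:R].
    apply: ((compact_near_coveringP K).1 cK) => x Kx.
    have Ux := KU x Kx.
    have [_ gx] := gP (c x) (imageP c Ux).
    exists ([set x' | g (c x') = g (c x)], [set G | g (c x) <= G%:R]) => /=.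
      split; first by apply: nbhs_chart (Uc _ Ux) gx _.
      exists (Num.trunc (g (c x))).+1 => // m /= mg.
      by rewrite (le_trans (ltW (truncnS_gt _)))// ler_nat.
    by move=> [x' m] [/= ->].
  by move=> [G _ GP]; exists G; apply: GP => /=.
exists G%:R => // E oE EU.
pose E' := E `&` [set y | g y <= G%:R].
have oE' : open E'.
  rewrite openE => y [Ey gy].
  have yE : nbhs y E by apply: open_nbhs_nbhs.
  apply: filterS2 yE (gP y (EU y Ey)).2 => z Ez gz.
  by split => //=; rewrite gz.
have open_part W : open W -> open (U `&` c @^-1` W).
  move=> oW; rewrite -(setIidl Uc) -setIA; apply: openI => //.
  exact: open_chart_preimage.
have mUE W : open W -> measurable (U `&` c @^-1` W : set (borel X)).
  by move=> /open_part; exact: measurable_open_manifold.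
have mCK : measurable (~` K : set (borel X)) by exact: measurableC.
apply: (@le_trans _ _ (mu (~` K `|` (U `&` c @^-1` E')))).
  apply: le_measure.
  - by apply: mem_set; exact: mUE.
  - by apply: mem_set; apply: measurableU => //; exact: mUE.
  - move=> x [Ux Ex]; have [Kx|] := pselect (K x); last by left.
    by right; split => //; split => //; exact: KG.
apply: le_trans (measureU2 _ mCK (mUE _ oE')) _.
rewrite [X in (X + _)%E](_ : _ = 0%E); last exact: K0.
rewrite [X in (_ + X)%E](_ : _ = (\int[haar]_(y in E') (g y)%:E)%E); last first.
  by apply: gE; [exact: measurable_open|move=> y [/EU]].
rewrite add0e.
apply: (@le_trans _ _ (\int[haar]_(y in E') (G%:R)%:E)%E).
  apply: ge0_integral_mono => y [Ey gy]; rewrite lee_fin//.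
  exact: (gP y (EU y Ey)).1.
rewrite integral_cst; last exact: measurable_open.
apply: lee_wpmul2l; first by rewrite lee_fin.
apply: le_measure; last by move=> y [].
- by apply: mem_set; exact: measurable_open.
- by apply: mem_set; exact: measurable_open.
Qed.

End on_manifold.

(** * Local integrability of a negative power *)

Section integrable_power.
Context {R : realType} {F : localFieldType R} {n : nat} (X : manifold F n).
Context (haar : {measure set (borel 'rV[F]_n) -> \bar R}) (haarP : is_haar haar).
Local Notation q := (lf_card F).

Lemma integrable_exponent_of_germ (J : set (X -> F)) (x0 : X) (h : X -> F) :
  germ_ideal J x0 h -> ~ (\forall x \near x0, h x = 0) ->
  exists2 s : R, 0 < s & forall (V : set X) r (f : 'I_r -> X -> F),
    germ_generators J x0 V f -> integrable_exponent haar x0 V f s.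
Proof.
move=> hJ hn0; have [[Vh [oVh Vhx0] hVh] _] := hJ.
have [c ac cx0] := mf_cover x0.
pose H := h \o chart_inv c.
have HE x : chart_dom c x -> H (c x) = h x by move=> cx; rewrite /H/= chart_invK.
have [coef [rho Hs]] := analytic_at_has_series (hVh c ac x0 Vhx0 cx0).
have coef0 : exists k, coef k != 0.
  apply: series_neq0 Hs _ => H0; apply: hn0.
  by apply: (nbhs_chart cx0 H0) => x cx; rewrite -(HE x cx).
have [N [lam [kap [lam0 lam1 kap0 HN]]]] := haar_sublevel_le haarP Hs coef0.
have alam0 : 0 < absF lam by rewrite absF_gt0.
have q0 : 0 < q%:R :> R by exact: lf_card_gt0.
pose b : R := q%:R^-1.
have b0 : 0 < b by rewrite invr_gt0.
have b1 : b < 1 by rewrite invf_lt1// ltr1_lf_card.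
(* The decay allows every exponent below [1 / N]; half of [1 / (N + 1)] is one
   of them and makes sense for [N = 0]. *)
pose s : R := N.+1%:R^-1 / 2.
have s0 : 0 < s by rewrite divr_gt0// invr_gt0.
exists s => // V r f [[oV Vx0] fV Jf].
have [C C0 hC] : exists2 C : R, 0 < C & \forall x \near x0,
    h x != 0 -> exists i, absF (h x) <= C * absF (f i x).
  by apply: germ_ideal_bound; rewrite -Jf.
pose W := [set x | h x != 0 -> exists i, absF (h x) <= C * absF (f i x)].
pose B := polydisc (c x0) (absF lam).
pose U := V `&` Vh `&` W° `&` (chart_dom c `&` c @^-1` B).
have oU : open U.
  apply: openI; last exact/open_chart_preimage/open_polydisc.
  by apply: openI; [exact: openI|exact: open_interior].
have Uc : U `<=` chart_dom c by move=> x [_ []].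
have cUB : c @` U `<=` B by move=> _ [x [_ [_ ?]] <-].
exists U; split.
- split => //; split; first by split.
  by split => // i; rewrite subrr absF0 ltW.
- by move=> x [[[]]].
move=> mu smu.
have [G G0 muG] := smooth_measure_le ac oU Uc smu.
have ocU : open (c @` U) by exact: open_chart_image.
have preU (E : set 'rV[F]_n) : U `&` c @^-1` (c @` U `&` E) = U `&` c @^-1` E.
  by apply/seteqP; split => x [Ux]; [move=> [_ Ex]|move=> Ex]; split => //;
    split => //; exists x.
(* The levels [kap * theta ^ m] must tend to [0], which those given by the decay,
   [kap * b ^ (m * N)], do not for [N = 0]. *)
pose theta := b ^+ N.+1.
have theta0 : 0 < theta by rewrite exprn_gt0.
pose Em m := c @` U `&` [set y | absF (H y) < kap * theta ^+ m].
have SE m : U `&` [set x | absF (h x) < kap * theta ^+ m] = U `&` c @^-1` Em m.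
  rewrite preU; apply/seteqP; split => x [Ux]/=.
    by rewrite -(HE x (Uc _ Ux)) => hx; split.
  by move=> hx; split => //=; rewrite -(HE x (Uc _ Ux)).
have oEm m : open (Em m).
  rewrite openE => _ [[x Ux <-] /= hx].
  have yU : nbhs (c x) (c @` U).
    by apply: open_nbhs_nbhs; split => //; exact: imageP.
  have Vhx : Vh x by case: Ux => -[[]].
  have /analytic_at_continuous := hVh c ac x Vhx (Uc _ Ux).
  move=> /(cvg_absFP (FG := nbhs_filter (c x)))/(_ (kap * theta ^+ m)).
  have tm0 : 0 < kap * theta ^+ m by rewrite mulr_gt0// exprn_gt0.
  move=> /(_ tm0); apply: filterS2 yU => z zU zx.
  split => //=; rewrite -(subrK (H (c x)) (H z)); exact: absFD_lt.
have oUEm m : open (U `&` c @^-1` Em m).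
  rewrite -(setIidl Uc) -setIA; apply: openI => //.
  exact: open_chart_preimage.
have haarEm m : (haar (Em m) <= (N%:R * b ^+ m)%:E)%E.
  rewrite /b exprVn; apply: HN => // y [yU Hy]; first exact: cUB.
  apply: (lt_le_trans Hy); rewrite ler_pM2l//.
  rewrite /theta -exprVn -/b -!exprM ler_wiXn2l ?ltW//.
  by rewrite mulSn mulnC leq_addl.
apply: (@sublevel_integrable _ _ _ mu U (fun x => absF (h x)) _ kap theta
  (G * N%:R) b s (C `^ s)) => //.
- exact: measurable_open_manifold.
- have -> : U = U `&` c @^-1` (c @` U).
    by apply/seteqP; split => x; [move=> Ux; split => //; exists x|case].
  apply: (le_lt_trans (muG _ ocU _)) => //.
  apply: (@le_lt_trans _ _ (G%:E * 1)%E); last by rewrite mule1 ltry.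
  apply: lee_wpmul2l; first by rewrite lee_fin.
  apply: le_trans (haar_polydisc_le1 haarP (c x0) alam0 lam1).
  by apply: le_measure => //; apply: mem_set; apply: measurable_open => //;
    exact: open_polydisc.
- by rewrite exprn_ilt1// ltW.
- rewrite /theta -powR_mulrn ?ltW// -powRrM /s mulrA divff ?pnatr_eq0//.
  rewrite mul1r powR12_sqrt ?ltW//.
  rewrite -{1}(sqr_sqrtr (ltW b0)) expr2 gtr_pMr ?sqrtr_gt0//.
  by rewrite -sqrtr1 ltr_sqrt.
- exact: powR_ge0.
- by move=> m; rewrite SE; exact: measurable_open_manifold.
- move=> m; rewrite SE; apply: (le_trans (muG _ (oEm m) _)); first by move=> y [].
  rewrite -mulrA EFinM; apply: lee_wpmul2l; first by rewrite lee_fin.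
  exact: haarEm.
- by move=> x _; exact: absF_ge0.
- move=> x _; apply/bigmin_geP; split; first by rewrite leey.
  by move=> i _; rewrite inve_ge0 lee_fin powR_ge0.
move=> x Ux; rewrite absF_eq0 => hx0.
have [i hi] : exists i, absF (h x) <= C * absF (f i x).
  by case: Ux => -[_ /interior_subset xW] _; exact: xW.
apply: (le_trans (bigmin_le _ i _)).
have hx : 0 < absF (h x) by rewrite absF_gt0.
have fx : 0 < absF (f i x).
  by rewrite -(pmulr_rgt0 _ C0) (lt_le_trans hx).
rewrite inver gt_eqF ?powR_gt0// lee_fin.
rewrite ler_pdivlMr ?powR_gt0// ler_pdivrMl ?powR_gt0// mulrC.
rewrite -powRM ?(ltW C0) ?absF_ge0//.
by rewrite ge0_ler_powR ?nnegrE ?mulr_ge0 ?absF_ge0 ?(ltW C0) ?(ltW s0).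
Qed.

End integrable_power.

Theorem theorem1p2 (R : realType) (F : localFieldType R) (n : nat)
    (haar : {measure set (borel 'rV[F]_n) -> \bar R}) (haarP : is_haar haar)
    (X : manifold F n) (x0 : X) (r : nat) (f : 'I_r -> X -> F)
    (f_analytic : forall i, analytic_on setT (f i))
    (J_neq0 : germ_neq0 (analytic_ideal f) x0) :
  exists eps : R, 0 < eps /\ (eps%:E < lct haar (analytic_ideal f) x0)%E.
Proof.
have [h hJ hn0] := J_neq0.
have [s s0 sP] := integrable_exponent_of_germ haarP hJ hn0.
exists (s / 2); split; first by rewrite divr_gt0.
apply: (@lt_le_trans _ _ s%:E).
  by rewrite lte_fin ltr_pdivrMr// mulr_natr mulr2n ltrDl.
by apply: ereal_sup_ubound; exists s => //; split => //; exact: ltW.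
Qed.
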